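(* Let $k\ge 1$ and $n\ge 0$ be integers. The number of elements of $C_k\wr S_n$ that bi-avoid the pattern $(1\text{-}2,\,0~0)$ equals $$\sum_{\substack{i_1+\cdots+i_k=n\\ i_1,\ldots,i_k\ge 0}}\binom{n}{i_1,\ldots,i_k}^2 .$$
   Context: For integers $k\ge1$, $n\ge0$, $C_k\wr S_n$ denotes the set of pairs $(\sigma,w)$ where $\sigma=\sigma_1\cdots\sigma_n$ is a permutation of $\{1,\dots,n\}$ in one-line notation and $w=w_1\cdots w_n\in\{0,1,\dots,k-1\}^n$ (the color of $\sigma_i$ is $w_i$). For a sequence of distinct integers $a_1\cdots a_j$, $\mathrm{red}(a_1\cdots a_j)$ is the permutation of $\{1,\dots,j\}$ obtained by replacing the $i$-th smallest entry by $i$; for a word $u$ over nonnegative integers, $\mathrm{red}(u)$ is obtained by replacing every occurrence of the $i$-th smallest distinct letter by $i-1$. A pattern $(\tau,u)$ consists of $\tau\in S_j$ and a word $u$ of length $j$ with $\mathrm{red}(u)=u$; the notation $(1\text{-}2,\,0~0)$ means $\tau=12$, $u=00$ (dashes indicate that the positions need not be adjacent). $(\tau,u)$ bi-occurs in $(\sigma,w)\in C_k\wr S_n$ if there are indices $1\le i_1<\cdots<i_j\le n$ with $\mathrm{red}(\sigma_{i_1}\cdots\sigma_{i_j})=\tau$ and $\mathrm{red}(w_{i_1}\cdots w_{i_j})=u$; $(\sigma,w)$ bi-avoids $(\tau,u)$ if there is no bi-occurrence. Thus $(\sigma,w)$ bi-avoids $(1\text{-}2,0~0)$ iff there are no $i<j$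 with $\sigma_i<\sigma_j$ and $w_i=w_j$. *)

(* Defs.v *)
(* MathComp *)
From mathcomp Require Import all_boot all_fingroup.
Set Implicit Arguments.
Unset Strict Implicit.
Unset Printing Implicit Defensive.

(* The elements of C_k wr S_n as a set; the group law plays no role. *)
Definition colored_perm (k n : nat) : finType := ('S_n * n.-tuple 'I_k)%type.

(* One-line notation with letters 1, ..., n: 'S_n permutes {0, ..., n-1},
   hence the shift. *)
Definition oneline (n : nat) (s : 'S_n) : seq nat := [seq (s i).+1 | i : 'I_n].

(* Meant for sequences of distinct integers, where the number of entries <= x
   is the rank of x, counted from 1. *)
Definition red_perm (a : seq nat) : seq nat :=
  [seq count (fun y => y <= x) a | x <- a].

(* The number of distinct letters < x is the rank of x among the distinct
   letters, counted from 0. *)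
Definition red_word (u : seq nat) : seq nat :=
  [seq count (fun y => y < x) (undup u) | x <- u].

Record pattern (j : nat) := Pattern {
  pat_perm : 'S_j;
  pat_word : j.-tuple nat;
  pat_word_red : red_word pat_word = pat_word
}.

Definition bi_occurs_at (k n j : nat) (p : pattern j) (x : colored_perm k n)
    (i : j.-tuple 'I_n) : bool :=
  [&& sorted ltn [seq val a | a <- i],
      red_perm [seq (x.1 a).+1 | a <- i] == oneline (pat_perm p)
    & red_word [seq val (tnth x.2 a) | a <- i] == pat_word p].

Definition bi_occurs (k n j : nat) (p : pattern j) (x : colored_perm k n) : bool :=
  [exists i : j.-tuple 'I_n, bi_occurs_at p x i].

Definition bi_avoids (k n j : nat) (p : pattern j) (x : colored_perm k n) : bool :=
  ~~ bi_occurs p x.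

(* (1-2, 0 0): the identity of 'S_2 has one-line notation 12. *)
Definition pat_12_00 : pattern 2 :=
  @Pattern 2 1%g [tuple 0; 0] (erefl [:: 0; 0]).

(* The quotient is exact when the i l sum to n. *)
Definition multinomial (n k : nat) (i : 'I_k -> nat) : nat :=
  n`! %/ \prod_(l < k) (i l)`!.

(* Main.v *)
(* Record a colored permutation [(s, w)] by the two words [w] (colors by
   position) and [w \o s^-1] (colors by value), which have the same content.
   Avoiding (1-2, 0 0) means that [s] is decreasing on each color class, so that
   [s] is the only such bijection from the positions to the values of each
   color. Hence the avoiders are counted by the pairs of words with the same
   content, and there are multinomially many words with a given content. *)
Require Import Defs.
From mathcomp Require Import all_boot all_fingroup.
Set Implicit Arguments.
Unset Strict Implicit.
Unset Printing Implicit Defensive.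

(** * Ranks inside the fibers of a map *)

(** For a strict total order [r], this is the position of [i], counted from 0, when its fiber is
    listed along [r]. *)
Definition fiber_rank (I C : finType) (r : rel I) (f : I -> C) (i : I) : nat :=
  #|[set j | (f j == f i) && r j i]|.

Lemma fiber_rank_lt (I C : finType) (r : rel I) (f : I -> C) (i j : I) :
  irreflexive r -> transitive r -> f i = f j -> r i j ->
  fiber_rank r f i < fiber_rank r f j.
Proof.
move=> irr tr fij rij; apply/proper_card/properP; split.
  apply/subsetP=> a; rewrite !inE fij => /andP[-> /= rai].
  exact: tr rai rij.
by exists i; rewrite !inE ?fij ?eqxx //= irr.
Qed.

Lemma fiber_rank_inj (I C : finType) (r : rel I) (f : I -> C) (i j : I) :
  irreflexive r -> transitive r -> (forall a b, a != b -> r a b || r b a) ->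
  f i = f j -> fiber_rank r f i = fiber_rank r f j -> i = j.
Proof.
move=> irr tr tot fij rk; apply/eqP/negPn/negP=> /tot /orP[] h.
  by have := fiber_rank_lt irr tr fij h; rewrite rk ltnn.
by have := fiber_rank_lt irr tr (esym fij) h; rewrite rk ltnn.
Qed.

Lemma fiber_rank_card (I C : finType) (r : rel I) (f : I -> C) (i : I) :
  irreflexive r -> fiber_rank r f i < #|[set j | f j == f i]|.
Proof.
move=> irr; apply/proper_card/properP; split.
  by apply/subsetP=> a; rewrite !inE => /andP[].
by exists i; rewrite !inE ?eqxx //= irr.
Qed.

(** Ranks are injective on a fiber and smaller than its size, so by counting they exhaust all values
    below that size. *)
Lemma fiber_rank_onto (I C : finType) (r : rel I) (f : I -> C) (c : C) (m : nat) :
  irreflexive r -> transitive r -> (forall a b, a != b -> r a b || r b a) ->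
  m < #|[set j | f j == c]| ->
  exists i, (f i == c) && (fiber_rank r f i == m).
Proof.
move=> irr tr tot mc; set D := [set j | f j == c] in mc.
(* The default [Ordinal mc] can only be returned outside [D], as [hE] shows. *)
pose h i : 'I_#|D| := insubd (Ordinal mc) (fiber_rank r f i).
have hE i : i \in D -> h i = fiber_rank r f i :> nat.
  rewrite inE => /eqP fi; rewrite val_insubd.
  by have := fiber_rank_card f i irr; rewrite fi -/D => ->.
have hinj : {in D &, injective h}.
  move=> i j Di Dj /(congr1 val) /=; rewrite !hE //.
  move: Di Dj; rewrite !inE => /eqP fi /eqP fj; apply: fiber_rank_inj => //.
  by rewrite fi fj.
have himg : h @: D = setT.
  by apply/eqP; rewrite eqEcard subsetT cardsT card_ord card_in_imset /=.
have: Ordinal mc \in h @: D by rewrite himg inE.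
case/imsetP=> i Di /(congr1 val) /= mE; exists i.
by rewrite -hE // -mE eqxx andbT; rewrite inE in Di.
Qed.

(** * The avoidance condition *)

Lemma bi_avoids_12_00P (k n : nat) (x : colored_perm k n) :
  reflect (forall i j : 'I_n, i < j -> tnth x.2 i = tnth x.2 j -> x.1 j < x.1 i)
          (bi_avoids pat_12_00 x).
Proof.
have one12 : oneline (1%g : 'S_2) = [:: 1; 2].
  by rewrite /oneline /image_mem enum_ordSl enum_ordSl enum_ord0 /= !perm1.
have occE i j : bi_occurs_at pat_12_00 x [tuple i; j] =
    [&& i < j, x.1 i < x.1 j & tnth x.2 i == tnth x.2 j].
  rewrite /bi_occurs_at /= one12 /red_perm /red_word /= andbT.
  rewrite !ltnS !leqnn /=; case: (i < j) => //=; congr andb.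
    by case: (ltngtP (x.1 i) (x.1 j)).
  (* If the two colors differ, the larger one reduces to 1, so only equal colors reduce to [0 0]. *)
  rewrite inE -val_eqE /=.
  case: ltngtP => [h|h|h] /=; rewrite ?ltnn ?h ?addn0 //.
  - by rewrite ltnNge ltnW.
  - by rewrite ltnn.
apply: (iffP idP) => [av i j ij wij | av].
  rewrite ltnNge leq_eqVlt; apply/negP => /orP[/eqP/val_inj/perm_inj eij|lt].
    by rewrite eij ltnn in ij.
  case/negP: av; apply/existsP; exists [tuple i; j].
  by rewrite occE ij lt wij eqxx.
apply/negP=> /existsP[[[|i [|j []]] // t2]].
rewrite (_ : Tuple t2 = [tuple i; j]); last exact: val_inj.
rewrite occE => /and3P[ij lt /eqP wij].
by have := ltn_trans lt (av _ _ ij wij); rewrite ltnn.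
Qed.

(** * Colors by value, and contents of words *)

Definition values_word (k n : nat) (x : colored_perm k n) : n.-tuple 'I_k :=
  [tuple tnth x.2 (x.1^-1%g a) | a < n].

Lemma tnth_values_word (k n : nat) (x : colored_perm k n) (i : 'I_n) :
  tnth (values_word x) (x.1 i) = tnth x.2 i.
Proof. by rewrite tnth_mktuple permK. Qed.

(** Bounding the counts by [n] makes the contents a finite type to sum over; [inord] loses nothing,
    since a letter occurs at most [n] times. *)
Definition content (C : finType) (n : nat) (w : n.-tuple C) : {ffun C -> 'I_n.+1} :=
  [ffun c => inord (count_mem c w)].

Lemma contentE (C : finType) (n : nat) (w : n.-tuple C) (c : C) :
  content w c = count_mem c w :> nat.
Proof. by rewrite ffunE inordK // ltnS -[leqRHS](size_tuple w) count_size. Qed.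

Lemma content_card (C : finType) (n : nat) (w : n.-tuple C) (c : C) :
  content w c = #|[set i | tnth w i == c]| :> nat.
Proof.
rewrite contentE -{1}(map_tnth_enum w) count_map cardsE cardE.
by rewrite enumT /enum_mem size_filter; apply: eq_count.
Qed.

Lemma sum_content (C : finType) (n : nat) (w : n.-tuple C) :
  \sum_c content w c = n.
Proof.
under eq_bigr do rewrite contentE -sum1_count.
rewrite (exchange_big_dep predT) //= -[RHS](size_tuple w) -sum1_size.
by apply: eq_bigr => a _; rewrite (big_pred1 a) // => c; apply: eq_sym.
Qed.

(** * Avoiders and pairs of words with the same content *)

Section AvoiderCount.
Variables k n : nat.

Let ltI : rel 'I_n := fun i j => i < j.
Let gtI : rel 'I_n := fun i j => j < i.

Let ltI_irr : irreflexive ltI. Proof. by move=> i; rewrite /ltI ltnn. Qed.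
Let gtI_irr : irreflexive gtI. Proof. by move=> i; rewrite /gtI ltnn. Qed.
Let ltI_tr : transitive ltI. Proof. by move=> j i l; apply: ltn_trans. Qed.
Let gtI_tr : transitive gtI.
Proof. by move=> j i l ji lj; apply: ltn_trans lj ji. Qed.
Let ltI_tot a b : a != b -> ltI a b || ltI b a.
Proof. by rewrite -val_eqE neq_ltn. Qed.
Let gtI_tot a b : a != b -> gtI a b || gtI b a.
Proof. by rewrite -val_eqE neq_ltn orbC. Qed.

(* [s] maps the earlier positions of a color onto its larger values. *)
Lemma avoider_rank (x : colored_perm k n) (i : 'I_n) : bi_avoids pat_12_00 x ->
  fiber_rank gtI (tnth (values_word x)) (x.1 i) = fiber_rank ltI (tnth x.2) i.
Proof.
move=> /bi_avoids_12_00P av; rewrite /fiber_rank tnth_values_word.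
rewrite -[RHS](card_imset _ (@perm_inj _ x.1)); apply: eq_card => a.
rewrite -[a](permKV x.1); set j := (x.1^-1%g a).
rewrite (mem_imset _ _ (@perm_inj _ x.1)) !inE tnth_values_word.
case: eqP => //= wji; rewrite /ltI /gtI.
case: (ltngtP j i) => [ji|ij|/val_inj->]; last by rewrite ltnn.
  exact: av.
by apply/negbTE; rewrite -leqNgt ltnW // av.
Qed.

(** The permutation maps the positions of each color bijectively onto the values of that color. *)
Lemma content_values_word (x : colored_perm k n) :
  content (values_word x) = content x.2.
Proof.
apply/ffunP=> c; apply/val_inj; rewrite /= !content_card.
rewrite -[RHS](card_imset _ (@perm_inj _ x.1)); apply: eq_card => a.
rewrite -[a](permKV x.1) (mem_imset _ _ (@perm_inj _ x.1)) !inE.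
by rewrite tnth_values_word.
Qed.

Lemma card_avoiders :
  #|[set x : colored_perm k n | bi_avoids pat_12_00 x]| =
  #|[set p : n.-tuple 'I_k * n.-tuple 'I_k | content p.1 == content p.2]|.
Proof.
pose F (x : colored_perm k n) := (x.2, values_word x).
rewrite -(@card_in_imset _ _ F) => [|x y]; last first.
  rewrite !inE => ax ay Fxy.
  have e2 : x.2 = y.2 := congr1 fst Fxy.
  have ev : values_word x = values_word y := congr1 snd Fxy.
  suff e1 : x.1 = y.1 by rewrite [x]surjective_pairing e1 e2 -surjective_pairing.
  (* Both images of [i] have the same color and the same decreasing rank in the common word of
     values. *)
  apply/permP=> i; apply: (fiber_rank_inj gtI_irr gtI_tr gtI_tot
      (f := tnth (values_word x))).
    by rewrite tnth_values_word ev tnth_values_word e2.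
  by rewrite (avoider_rank i ax) ev (avoider_rank i ay) e2.
apply: eq_card => -[w v]; rewrite inE /=; apply/imsetP/eqP => [[x _ [-> ->]]|cwv].
  by rewrite content_values_word.
(* Surjectivity: position [i] must go to the value of its color whose decreasing rank is the
   increasing rank of [i]. It exists because equal contents give fibers of equal size. *)
have ex i : exists a, (tnth v a == tnth w i) &&
    (fiber_rank gtI (tnth v) a == fiber_rank ltI (tnth w) i).
  apply: fiber_rank_onto => //.
  by rewrite -content_card -cwv content_card fiber_rank_card.
pose s i := xchoose (ex i).
have sP i : tnth v (s i) = tnth w i /\
    fiber_rank gtI (tnth v) (s i) = fiber_rank ltI (tnth w) i.
  by have /andP[/eqP ? /eqP ?] := xchooseP (ex i).
have s_inj : injective s.
  move=> i j sij; have [vi ri] := sP i; have [vj rj] := sP j.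
  apply: (fiber_rank_inj ltI_irr ltI_tr ltI_tot (f := tnth w)).
    by rewrite -vi -vj sij.
  by rewrite -ri -rj sij.
exists (perm s_inj, w).
  rewrite inE; apply/bi_avoids_12_00P => i j /= ij wij; rewrite !permE.
  have [vi ri] := sP i; have [vj rj] := sP j.
  (* The later position has the larger rank, hence its image has the larger decreasing rank, that
     is, the smaller value. *)
  have := fiber_rank_lt ltI_irr ltI_tr wij ij; rewrite -ri -rj.
  case: (ltngtP (s i) (s j)) => // [sij|/val_inj->]; last by rewrite ltnn.
  have vv : tnth v (s j) = tnth v (s i) by rewrite vi vj wij.
  have := fiber_rank_lt gtI_irr gtI_tr vv sij.
  by move=> h1 /(ltn_trans h1); rewrite ltnn.
congr pair; apply: eq_from_tnth => a.
rewrite -[a](permKV (perm s_inj)); set i := (perm s_inj)^-1%g a.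
by rewrite (tnth_values_word (perm s_inj, w)) permE (sP i).1.
Qed.

End AvoiderCount.

(** * Counting words with a given content *)

(** The product form keeps the induction free of division: in length [n.+1], a first letter [d]
    contributes [m d * n!], and the [m d] sum to [n.+1]. *)
Lemma card_words_mul_fact (C : finType) (n : nat) (m : C -> nat) :
  \sum_c m c = n ->
  #|[set w : n.-tuple C | [forall c, count_mem c w == m c]]| *
    \prod_c (m c)`! = n`!.
Proof.
elim: n m => [|n IHn] m sum_m.
  have m0 c : m c = 0.
    by apply/eqP; move/eqP: sum_m; rewrite sum_nat_eq0 => /forallP/(_ c).
  rewrite big1 ?muln1 => [|c _]; last by rewrite m0.
  rewrite (_ : [set _ | _] = setT) ?cardsT ?card_tuple //.
  by apply/setP=> w; rewrite !inE tuple0; apply/forallP=> c; rewrite m0.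
(* The words starting with [d] biject with the words of content [m - d]. *)
pose m' d c := m c - (c == d).
(* Truncated subtraction gives [m' d = m] pointwise when [m d = 0]; the guard [0 < m d] rules out
   such a first letter. *)
have headE d (w : n.-tuple C) :
    [forall c, count_mem c (cons_tuple d w) == m c] =
    (0 < m d) && [forall c, count_mem c w == m' d c].
  apply/forallP/andP => [h|[md /forallP h] c].
    have md : 0 < m d by rewrite -(eqP (h d)) /= eqxx.
    split=> //; apply/forallP=> c; rewrite /m' -(eqP (h c)) /=.
    by rewrite [d == c]eq_sym addKn.
  rewrite /= (eqP (h c)) /m' [d == c]eq_sym; case: (c =P d) => [->|_] /=.
    by rewrite addnC subnK.
  by rewrite add0n subn0.
have cons_bij : bijective (fun p : C * n.-tuple C => cons_tuple p.1 p.2).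
  exists (fun w : n.+1.-tuple C => (thead w, [tuple of behead w])).
    by move=> [d w] /=; congr pair; apply: val_inj.
  by move=> w; rewrite [RHS]tuple_eta; apply: val_inj.
rewrite -sum1_card (reindex _ (onW_bij _ cons_bij)) /=.
rewrite (eq_bigl (fun p : C * n.-tuple C =>
   (0 < m p.1) && [forall c, count_mem c p.2 == m' p.1 c])); last first.
  by move=> [d w]; rewrite inE headE.
rewrite -(pair_big_dep (fun d => 0 < m d)
   (fun d w => [forall c, count_mem c (w : n.-tuple C) == m' d c])
   (fun _ _ => 1)) /= big_distrl /=.
rewrite factS -sum_m big_distrl /= [RHS](bigID (fun d => 0 < m d)) /=.
rewrite [X in _ + X]big1 ?addn0 => [|d]; last by case: (m d).
apply: eq_bigr => d md.
have sum_m' : \sum_c m' d c = n.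
  apply/eqP; rewrite -eqSS -sum_m (bigD1 d) //= [X in _ == X](bigD1 d) //=.
  rewrite /m' eqxx subn1 -addSn prednK // eqn_add2l; apply/eqP.
  by apply: eq_bigr => c /negbTE->; rewrite subn0.
rewrite -(IHn _ sum_m') mulnCA -sum1_card; congr (_ * _).
  by apply: eq_bigl => w; rewrite inE.
(* Passing from [m] to [m' d] changes only the factorial at [d], which loses the factor [m d]. *)
rewrite (bigD1 d) //= [in RHS](bigD1 d) //= mulnA /m' eqxx subn1.
rewrite -[in LHS](prednK md) factS (prednK md); congr (_ * _).
by apply: eq_bigr => c /negbTE->; rewrite subn0.
Qed.

(** Letter counts of a word add up to its length, so any other [m] is the content of no word;
    otherwise the product formula makes the division exact. *)
Lemma card_content (C : finType) (n : nat) (m : {ffun C -> 'I_n.+1}) :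
  #|[set w : n.-tuple C | content w == m]| =
  if \sum_c m c == n then n`! %/ \prod_c (m c)`! else 0.
Proof.
case: eqP => [sum_m|sum_m]; last first.
  apply/eqP; rewrite cards_eq0; apply/eqP/setP=> w; rewrite !inE.
  by apply/eqP=> wm; case: sum_m; rewrite -wm sum_content.
rewrite -(card_words_mul_fact sum_m) mulnK; last first.
  by apply: prodn_gt0 => c; apply: fact_gt0.
apply: eq_card => w; rewrite !inE; apply/eqP/forallP => [<- c|h].
  by rewrite contentE.
by apply/ffunP=> c; apply/val_inj; rewrite /= contentE; apply/eqP.
Qed.

(* Parts of a composition of n are at most n, so they range over 'I_n.+1. *)
Theorem theorem1 (k n : nat) (hk : 1 <= k) :
  #|[set x : colored_perm k n | bi_avoids pat_12_00 x]| =
  \sum_(i : {ffun 'I_k -> 'I_n.+1} | \sum_(l < k) i l == n)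
    multinomial n (fun l => i l) ^ 2.
Proof.
rewrite card_avoiders -sum1_card.
(* Pairs are grouped by their common content [m]. Each group is a square [setX W W], empty when [m]
   does not sum to [n]. *)
rewrite (partition_big (fun p => content p.1) predT) //= [RHS]big_mkcond /=.
apply: eq_bigr => m _.
have := card_content m; rewrite -/(multinomial n (fun l => m l)).
set W := [set w | _] => cardW.
transitivity #|setX W W|.
  rewrite -sum1_card; apply: eq_bigl => -[w v]; rewrite !inE /=.
  by case: (content w =P m) => [->|]; rewrite ?andbF ?andbT // eq_sym.
by rewrite cardsX cardW; case: ifP.
Qed.
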